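(* Let $\mathbf A=(A,\le,0,1)$ be a bounded MLUB-complete poset and $\mathbf T=(T,R)$ a time frame with $R$ serial. Then $${}_{\mathbf T}P_{\mathbf A}={}_{\mathbf T}H_{\mathbf A^{op}}={}_{\mathbf T^{op}}F_{\mathbf A}={}_{\mathbf T^{op}}G_{\mathbf A^{op}}.$$ Moreover, if $\mathbf A'=(A',\le')$ is a poset and $f:\mathbf A\to\mathbf A'$ is an isomorphism of posets, then $(\mathcal P_+f)^T\circ{}_{\mathbf T}X_{\mathbf A}={}_{\mathbf T}X_{\mathbf A'}\circ\mathcal P_+(f^T)$ for every $X\in\{P,F,H,G\}$.
   Context: For a poset and $X\subseteq A$: $L(X)$, $U(X)$ the sets of lower/upper bounds, $\operatorname{Max}X,\operatorname{Min}X$ the maximal/minimal elements. MLUB-complete: for every nonempty $M$, every upper bound of $M$ lies above a minimal upper bound and every lower bound below a maximal lower bound. $\mathcal P_+(X)$ = nonempty subsets. A time frame $\mathbf T=(T,R)$: $T\ne\emptyset$, $R\subseteq T^2$; serial: each $s$ has $r,t$ with $rRs$, $sRt$. $\mathbf A^{op}=(A,\ge)$ is the dual poset, $\mathbf T^{op}=(T,R^{-1})$ where $sR^{-1}t$ iff $tRs$. For a bounded MLUB-complete poset $\mathbf A$ and time frame $\mathbf T$ with serial relation, the induced tense operators ${}_{\mathbf T}P_{\mathbf A},{}_{\mathbf T}F_{\mathbf A},{}_{\mathbf T}H_{\mathbf A},{}_{\mathbf T}G_{\mathbf A}:\mathcal P_+(A^T)\to(\mathcal P_+A)^T$ are ${}_{\mathbf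 T}P_{\mathbf A}(B)(s)=\operatorname{Min}U(\{q(t)\mid q\in B,tRs\})$, ${}_{\mathbf T}F_{\mathbf A}(B)(s)=\operatorname{Min}U(\{q(t)\mid q\in B,sRt\})$, ${}_{\mathbf T}H_{\mathbf A}(B)(s)=\operatorname{Max}L(\{q(t)\mid q\in B,tRs\})$, ${}_{\mathbf T}G_{\mathbf A}(B)(s)=\operatorname{Max}L(\{q(t)\mid q\in B,sRt\})$, with $L,U,\operatorname{Max},\operatorname{Min}$ computed in $\mathbf A$. For $f:A\to A'$: $\mathcal P_+(f^T):\mathcal P_+(A^T)\to\mathcal P_+(A'^T)$, $B\mapsto\{f\circ b\mid b\in B\}$, and $(\mathcal P_+f)^T:(\mathcal P_+A)^T\to(\mathcal P_+A')^T$, $Z\mapsto(t\mapsto f[Z(t)])$. *)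

(* Defs.v *)
From HB Require Import structures.
From mathcomp Require Import all_boot all_order.
From mathcomp Require Import boolp classical_sets.

Set Implicit Arguments.
Unset Strict Implicit.
Unset Printing Implicit Defensive.

Import Order.TTheory.
Local Open Scope classical_set_scope.
Local Open Scope order_scope.

Section Posets.
Context {d : Order.disp_t} {A : porderType d}.
Implicit Types (M X : set A).

Definition minimals X : set A :=
  [set x | X x /\ forall y, X y -> y <= x -> y = x].

Definition maximals X : set A :=
  [set x | X x /\ forall y, X y -> x <= y -> y = x].

End Posets.

Definition MLUB_complete (d : Order.disp_t) (A : porderType d) : Prop :=
  forall M : set A, M !=set0 ->
    (forall u, ubound M u -> exists2 m, minimals (ubound M) m & m <= u) /\
    (forall l, lbound M l -> exists2 m, maximals (lbound M) m & l <= m).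

(* Boundedness as a property of a bare poset, so that it can also be asserted
   of a poset carrying no distinguished bottom and top. *)
Definition bounded_poset (d : Order.disp_t) (A : porderType d) : Prop :=
  (exists bot : A, forall x, bot <= x) /\ (exists top : A, forall x, x <= top).

Definition bounded_MLUB (d : Order.disp_t) (A : porderType d) : Prop :=
  bounded_poset A /\ MLUB_complete A.

Lemma tb_bounded_MLUB (d : Order.disp_t) (A : tbPOrderType d) :
  MLUB_complete A -> bounded_MLUB A.
Proof.
move=> hA; split=> //; split.
  by exists \bot => x; exact: le0x.
by exists \top => x; exact: lex1.
Qed.

Lemma dual_bounded_MLUB (d : Order.disp_t) (A : porderType d) :
  bounded_MLUB A -> bounded_MLUB A^d.
Proof.
move=> [[hbot htop] hA]; split; first by split.
by move=> M /hA [hU hL]; split.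
Qed.

Definition poset_iso (d d' : Order.disp_t) (A : porderType d)
    (A' : porderType d') (f : A -> A') : Prop :=
  bijective f /\ {mono f : x y / x <= y}.

Lemma iso_bounded_MLUB (d d' : Order.disp_t) (A : porderType d)
    (A' : porderType d') (f : A -> A') :
  poset_iso f -> bounded_MLUB A -> bounded_MLUB A'.
Proof.
move=> [[g fK gK] fm] [[[b hb] [t ht]] hA].
have gm x y : (g x <= g y) = (x <= y) by rewrite -fm !gK.
split.
  split; [exists (f b) | exists (f t)] => x.
    by rewrite -[x]gK fm.
  by rewrite -[x]gK fm.
move=> M M0; have [|hU hL] := hA (g @` M); first exact: image_nonempty.
have ubE x : ubound (g @` M) x <-> ubound M (f x).
  split=> h y.
    by move=> My; rewrite -[y]gK fm; apply: h; exists y.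
  by move=> [z Mz <-]; rewrite -fm gK; exact: h.
have lbE x : lbound (g @` M) x <-> lbound M (f x).
  split=> h y.
    by move=> My; rewrite -[y]gK fm; apply: h; exists y.
  by move=> [z Mz <-]; rewrite -fm gK; exact: h.
split=> u hu.
  have [|m [mU mmin] mu] := hU (g u); first by apply/ubE; rewrite gK.
  exists (f m); last by rewrite -[u]gK fm.
  split; first exact/ubE.
  move=> y yU ym; rewrite -[y]gK; congr f; apply: mmin.
    by apply/ubE; rewrite gK.
  by rewrite -fm gK.
have [|m [mL mmax] um] := hL (g u); first by apply/lbE; rewrite gK.
exists (f m); last by rewrite -[u]gK fm.
split; first exact/lbE.
move=> y yL my; rewrite -[y]gK; congr f; apply: mmax.
  by apply/lbE; rewrite gK.
by rewrite -fm gK.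
Qed.

Record timeFrame := TimeFrame {
  tf_sort :> Type;
  tf_rel : tf_sort -> tf_sort -> Prop;
  tf_inhabited : inhabited tf_sort
}.

Definition serial (T : timeFrame) : Prop :=
  forall s : T, (exists r : T, tf_rel r s) /\ (exists t : T, tf_rel s t).

Definition tf_op (T : timeFrame) : timeFrame :=
  @TimeFrame T (fun s t => tf_rel t s) (tf_inhabited T).

Lemma serial_op (T : timeFrame) : serial T -> serial (tf_op T).
Proof. by move=> hT s; have [hp hf] := hT s; split. Qed.

Definition Pplus (X : Type) : Type := {B : set X | B !=set0}.

Definition Pplus_map (X Y : Type) (g : X -> Y) (B : Pplus X) : Pplus Y :=
  exist _ (g @` sval B) (image_nonempty g (svalP B)).

(* P_+(f^T) *)
Definition Pplus_pow (T A A' : Type) (f : A -> A') :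
    Pplus (T -> A) -> Pplus (T -> A') :=
  Pplus_map (fun b : T -> A => f \o b).

(* (P_+ f)^T *)
Definition pow_Pplus (T A A' : Type) (f : A -> A') :
    (T -> Pplus A) -> (T -> Pplus A') :=
  fun Z t => Pplus_map f (Z t).

Section TenseOperators.
Context {d : Order.disp_t} {A : porderType d} {T : timeFrame}.
Hypotheses (hA : bounded_MLUB A) (hT : serial T).
Implicit Types (B : Pplus (T -> A)) (s : T).

Definition past_values B s : set A :=
  [set x | exists q t, [/\ sval B q, tf_rel t s & x = q t]].

Definition future_values B s : set A :=
  [set x | exists q t, [/\ sval B q, tf_rel s t & x = q t]].

Lemma past_values_nonempty B s : past_values B s !=set0.
Proof.
have [q Bq] := svalP B; have [[r rs] _] := hT s.
by exists (q r), q, r.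
Qed.

Lemma future_values_nonempty B s : future_values B s !=set0.
Proof.
have [q Bq] := svalP B; have [_ [r rs]] := hT s.
by exists (q r), q, r.
Qed.

Lemma minU_nonempty (M : set A) : M !=set0 -> minimals (ubound M) !=set0.
Proof.
move=> M0; case: hA => [[_ [t ht]] hM].
by have [m mU _] := (hM M M0).1 t (fun x _ => ht x); exists m.
Qed.

Lemma maxL_nonempty (M : set A) : M !=set0 -> maximals (lbound M) !=set0.
Proof.
move=> M0; case: hA => [[[b hb] _] hM].
by have [m mL _] := (hM M M0).2 b (fun x _ => hb x); exists m.
Qed.

Definition tenseP : Pplus (T -> A) -> T -> Pplus A := fun B s =>
  exist _ (minimals (ubound (past_values B s)))
    (minU_nonempty (past_values_nonempty B s)).

Definition tenseF : Pplus (T -> A) -> T -> Pplus A := fun B s =>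
  exist _ (minimals (ubound (future_values B s)))
    (minU_nonempty (future_values_nonempty B s)).

Definition tenseH : Pplus (T -> A) -> T -> Pplus A := fun B s =>
  exist _ (maximals (lbound (past_values B s)))
    (maxL_nonempty (past_values_nonempty B s)).

Definition tenseG : Pplus (T -> A) -> T -> Pplus A := fun B s =>
  exist _ (maximals (lbound (future_values B s)))
    (maxL_nonempty (future_values_nonempty B s)).

End TenseOperators.

(* Main.v *)
Require Import Defs.
From HB Require Import structures.
From mathcomp Require Import all_boot all_order.
From mathcomp Require Import boolp classical_sets.

Set Implicit Arguments.
Unset Strict Implicit.
Unset Printing Implicit Defensive.

Local Open Scope classical_set_scope.

(** All four operators are one construction up to two reversals: the dual order swaps [ubound] with
    [lbound] and [minimals] with [maximals], and inverting the time relation swaps [past_values]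
    with [future_values]. The chain of equalities is therefore definitional, up to proofs of
    nonemptiness. Naturality in [f] splits into two facts: forming the value sets commutes with
    direct images for any map ([past_values_Pplus_pow]), and an isomorphism preserves minimal upper
    bounds ([image_minimals_ubound]); the other cases follow by the two reversals. *)

(** Proof irrelevance: the differing boundedness and seriality proofs given to the operators only
    affect the nonemptiness component. *)
Lemma Pplus_eq (X : Type) (B C : Pplus X) : sval B = sval C -> B = C.
Proof. by case: B C => [B hB] [C hC]; exact: eq_exist. Qed.

Lemma poset_iso_dual (d d' : Order.disp_t) (A : porderType d)
    (A' : porderType d') (f : A -> A') :
  poset_iso f -> poset_iso (f : A^d -> A'^d).
Proof. by move=> [fbij fm]; split=> // x y; exact: fm. Qed.

(** Since [f] preserves and reflects the order, upper bounds and comparisons between them transfer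
    both ways; surjectivity puts every competitor in [A'] in the form [f x]. *)
Lemma image_minimals_ubound (d d' : Order.disp_t) (A : porderType d)
    (A' : porderType d') (f : A -> A') (M : set A) :
  poset_iso f -> f @` minimals (ubound M) = minimals (ubound (f @` M)).
Proof.
move=> [[g fK gK] fm].
have ubE x : ubound (f @` M) (f x) <-> ubound M x.
  split=> h y; first by move=> My; rewrite -fm; apply: h; exists y.
  by move=> [z Mz <-]; rewrite fm; exact: h.
apply/seteqP; split=> [_ [x [xU xmin] <-]|y [yU ymin]].
  split=> [|y yU yx]; first exact/ubE.
  (* Writing [y] as [f (g y)] pulls the competitor back to [A], where minimality of [x] applies. *)
  rewrite -[y]gK in yU yx *; congr f; apply: xmin; first exact/ubE.
  by rewrite -fm.
exists (g y); last exact: gK.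
split=> [|z zU zy]; first by apply/ubE; rewrite gK.
by apply: (can_inj fK); rewrite gK; apply: ymin; [exact/ubE | rewrite -[y]gK fm].
Qed.

(** Maximal lower bounds in [A] are, by conversion, minimal upper bounds in [A^d]. *)
Lemma image_maximals_lbound (d d' : Order.disp_t) (A : porderType d)
    (A' : porderType d') (f : A -> A') (M : set A) :
  poset_iso f -> f @` maximals (lbound M) = maximals (lbound (f @` M)).
Proof. by move/poset_iso_dual/image_minimals_ubound; apply. Qed.

Lemma past_values_Pplus_pow (d d' : Order.disp_t) (A : porderType d)
    (A' : porderType d') (T : timeFrame) (f : A -> A')
    (B : Pplus (T -> A)) (s : T) :
  past_values (Pplus_pow f B) s = f @` past_values B s.
Proof.
apply/seteqP; split=> [_ [_ [t [[q Bq <-] ts ->]]]|_ [_ [q [t [Bq ts ->]]] <-]].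
  by exists (q t) => //; exists q, t.
by exists (f \o q), t; split=> //; exists q.
Qed.

(** The future in [T] is, by conversion, the past in [tf_op T]. *)
Lemma future_values_Pplus_pow (d d' : Order.disp_t) (A : porderType d)
    (A' : porderType d') (T : timeFrame) (f : A -> A')
    (B : Pplus (T -> A)) (s : T) :
  future_values (Pplus_pow f B) s = f @` future_values B s.
Proof. exact: (@past_values_Pplus_pow _ _ _ _ (tf_op T)). Qed.

Theorem theorem3p4 (d : Order.disp_t) (A : tbPOrderType d) (T : timeFrame)
    (hA : MLUB_complete A) (hT : serial T) :
  let bA := tb_bounded_MLUB hA in
  let bAop := dual_bounded_MLUB bA in
  let hTop := serial_op hT in
  [/\ tenseP bA hT = tenseH bAop hT :> (Pplus (T -> A) -> T -> Pplus A),
      tenseH bAop hT = tenseF bA hTop :> (Pplus (T -> A) -> T -> Pplus A) &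
      tenseF bA hTop = tenseG bAop hTop :> (Pplus (T -> A) -> T -> Pplus A)] /\
  (forall (d' : Order.disp_t) (A' : porderType d') (f : A -> A')
      (hf : poset_iso f),
    let bA' := iso_bounded_MLUB hf bA in
    [/\ @pow_Pplus T A A' f \o tenseP bA hT
          = tenseP bA' hT \o @Pplus_pow T A A' f,
        @pow_Pplus T A A' f \o tenseF bA hT
          = tenseF bA' hT \o @Pplus_pow T A A' f,
        @pow_Pplus T A A' f \o tenseH bA hT
          = tenseH bA' hT \o @Pplus_pow T A A' f &
        @pow_Pplus T A A' f \o tenseG bA hT
          = tenseG bA' hT \o @Pplus_pow T A A' f]).
Proof.
move=> bA bAop hTop; split.
  (* Once [Pplus_eq] discards the nonemptiness proofs, both sides are convertible sets. *)
  by split; apply/funext=> B; apply/funext=> s; exact: Pplus_eq.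
move=> d' A' f hf bA'.
split; apply/funext=> B; apply/funext=> s; apply: Pplus_eq => /=.
- by rewrite past_values_Pplus_pow image_minimals_ubound.
- by rewrite future_values_Pplus_pow image_minimals_ubound.
- by rewrite past_values_Pplus_pow image_maximals_lbound.
- by rewrite future_values_Pplus_pow image_maximals_lbound.
Qed.
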